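(* There exist absolute constants $C_0, C_1, C_2 > 0$ such that the following holds. Fix $\alpha$, $r$, $d_1$, $d_2$ such that $\alpha, d_1, d_2 \geq 1$, $r\geq 4$ and $\alpha^2 r\max\{d_1,d_2\}\geq C_0$. Assume that for all $k\in[K-1]$, $f_k$ is decreasing and its derivative $f_k'$ is increasing in $[\alpha-1/4,\alpha]$, and that $f_K(\alpha-1/4)>1/2$. Let $\Omega$ be any subset of $[d_1]\times[d_2]$ with cardinality $m$. For $M\in\mathcal{S}$, let $Y$ be the observations with $Y_{ij}=a_k$ with probability $f_k(M_{ij})$, $k \in [K]$, for $(i,j)\in\Omega$, and let $\beta_\alpha^+$ be the constant in the assumptions on the link functions (see context). Consider any algorithm which, for any $M\in\mathcal{S}$, returns an estimator $\widehat{M}$ (from the observations $Y_{ij}$, $(i,j)\in\Omega$). Then there exists $M\in\mathcal{S}$ such that with probability at least $3/4$, $$\frac{1}{d_1 d_2}\|M-\widehat{M}\|_F^2 \geq \min\left\{C_1,\ C_2\frac{\alpha}{\sqrt{K\beta_\alpha^+}}\sqrt{\frac{r\max\{d_1,d_2\}}{m}}\right\},$$ as long as the right-hand side of this inequality exceeds $r\alpha^2/\min\{d_1,d_2\}$.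
   Context: Notation: $[d]=\{1,\dots,d\}$; $\|\cdot\|_F$ is the Frobenius norm and $\|\cdot\|_*$ the nuclear norm (sum of singular values). $K$ is the number of categories and $\{a_1,\dots,a_K\}$ is the set of $K$ distinct possible observed values. Given $M$, the observations $Y_{ij}$, $(i,j)\in\Omega$, are independent with $\mathbb{P}(Y_{ij}=a_k)=f_k(M_{ij})$. Link functions: $f_1,\dots,f_K$ are differentiable, with $\sum_{k=1}^K f_k(x)=1$ and $f_k(x)>0$ for $x\in[-\alpha,\alpha]$. Define $$L_\alpha^{(k)} = \sup_{|x|\le\alpha}\frac{|f_k'(x)|}{f_k(x)},\qquad \beta_\alpha(x)=\max_{1\le k\le K}\frac{(f_k'(x))^2}{f_k(x)}.$$ It is assumed that there are positive constants $L_\alpha,\beta_\alpha^-,\beta_\alpha^+$ such that $\max_{1\le k\le K}L_\alpha^{(k)}\le L_\alpha$, $\inf_{|x|\le\alpha}\beta_\alpha(x)\ge\beta_\alpha^-$ and $\sup_{|x|\le\alpha}\beta_\alpha(x)\le\beta_\alpha^+$. Candidate set: $$\mathcal{S}=\left\{X\in\mathbb{R}^{d_1\times d_2}:\ \|X\|_*\le\alpha\sqrt{r d_1 d_2},\ -\alpha\le X_{ij}\le\alpha\ \ \forall (i,j)\in[d_1]\times[d_2]\right\}.$$ *)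

(* Defs.v *)
From HB Require Import structures.
From mathcomp Require Import all_boot all_order all_algebra.
From mathcomp Require Import polyrcf.
From mathcomp Require Import all_classical all_reals all_analysis.
Set Implicit Arguments.
Unset Strict Implicit.
Unset Printing Implicit Defensive.
Import Order.TTheory GRing.Theory Num.Theory.
Import numFieldNormedType.Exports.
Local Open Scope classical_set_scope.
Local Open Scope ring_scope.

Definition frobenius_norm (R : realType) (m n : nat) (A : 'M[R]_(m, n)) : R :=
  Num.sqrt (\sum_i \sum_j A i j ^+ 2).

(* Sum of the singular values, i.e. of the square roots of the eigenvalues of
   A^T A.  [rootsR] lists each real root once, hence the multiplicity [mup];
   the characteristic polynomial of A^T A has only real roots.  When n > m the
   extra eigenvalues of A^T A are 0 and contribute nothing. *)
Definition nuclear_norm (R : realType) (m n : nat) (A : 'M[R]_(m, n)) : R :=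
  let p := char_poly (A^T *m A) in
  \sum_(x <- rootsR p) Num.sqrt x *+ mup x p.

Definition candidate_set (R : realType) (d1 d2 : nat) (alpha r : R) :
    set 'M[R]_(d1, d2) :=
  [set X | nuclear_norm X <= alpha * Num.sqrt (r * d1%:R * d2%:R) /\
           forall i j, - alpha <= X i j <= alpha].

(* The suprema and infima over [-alpha, alpha] are taken in \bar R: [sup] of an
   unbounded set of reals is 0, which would make the upper bounds below hold
   for free. *)
Definition link_L (R : realType) (K : nat) (alpha : R) (f : 'I_K -> R -> R)
    (k : 'I_K) : \bar R :=
  ereal_sup [set (`|(f k)^`()%classic x| / f k x)%:E | x in `[- alpha, alpha]].

(* The default 0 is neutral: the terms are nonnegative where f_k > 0. *)
Definition link_beta (R : realType) (K : nat) (f : 'I_K -> R -> R) (x : R) : R :=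
  \big[Num.max/0]_(k < K) ((f k)^`()%classic x ^+ 2 / f k x).

Record link_functions (R : realType) (K : nat) (alpha : R)
    (f : 'I_K -> R -> R) (L betam betap : R) : Prop := LinkFunctions {
  link_derivable : forall k (x : R), derivable (f k) x 1;
  link_sum1 : forall x : R, x \in `[- alpha, alpha] -> \sum_(k < K) f k x = 1;
  link_gt0 : forall k (x : R), x \in `[- alpha, alpha] -> 0 < f k x;
  link_L_gt0 : 0 < L;
  link_betam_gt0 : 0 < betam;
  link_betap_gt0 : 0 < betap;
  link_L_le : forall k, (link_L alpha f k <= L%:E)%E;
  link_beta_ge :
    (betam%:E <= ereal_inf [set (link_beta f x)%:E | x in `[(- alpha)%R, alpha]])%E;
  link_beta_le :
    (ereal_sup [set (link_beta f x)%:E | x in `[(- alpha)%R, alpha]] <= betap%:E)%E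
}.

(* [Y] is a family of independent observations, one for each entry in [Omega],
   with values in {a_1, ..., a_K} (a discrete set, so that any [B] below is a
   legitimate event) and P(Y_ij = a_k) = f_k(M_ij).  Taking some of the [B e]
   to be [setT] gives the product rule for subfamilies. *)
Record observations (R : realType) (d1 d2 K : nat) (f : 'I_K -> R -> R)
    (A : Type) (a : 'I_K -> A) (Omega : {set 'I_d1 * 'I_d2})
    (M : 'M[R]_(d1, d2)) (dT : measure_display) (T : measurableType dT)
    (P : probability T R) (Y : {e | e \in Omega} -> T -> A) : Prop :=
  Observations {
    obs_range : forall e t, range a (Y e t);
    obs_measurable : forall e k, measurable (Y e @^-1` [set a k]);
    obs_law : forall e k,
      P (Y e @^-1` [set a k]) = (f k (M (val e).1 (val e).2))%:E;
    obs_indep : forall B : {e | e \in Omega} -> set A,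
      P [set t | forall e, B e (Y e t)] = (\prod_e P (Y e @^-1` B e))%E
  }.

(* min {C1, C2 * alpha / sqrt (K beta) * sqrt (r max(d1, d2) / m)}, where the
   last square root is read as +oo for m = 0. *)
Definition lower_rate (R : realType) (C1 C2 alpha r betap : R)
    (d1 d2 K m : nat) : R :=
  if m == 0%N then C1
  else Num.min C1 (C2 * (alpha / Num.sqrt (K%:R * betap)) *
                   Num.sqrt (r * (maxn d1 d2)%:R / m%:R)).

(* Main.v *)
Require Import Defs.
From HB Require Import structures.
From mathcomp Require Import all_boot all_order all_algebra.
From mathcomp Require Import polyrcf complex.
From mathcomp Require Import all_classical all_reals all_analysis.
From mathcomp Require Import measurable_realfun.
From mathcomp Require Import ring lra zify.

(** The lower bound reduces estimation to a test among many hypotheses.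

    Candidates. All candidates have entries [alpha] or [alpha - gap], with
    [gap ^+ 2 = 64 * rate].  A binary array with [maxn d1 d2] rows and [B]
    columns is repeated periodically along the shorter side of the matrix, so
    that the rank is at most [B] ([cell_layout]).  Such a matrix is the constant
    [alpha] up to a perturbation of size [gap] and rank about [B]; its nuclear
    norm is bounded by [nuclear_norm_le], where the largest singular value
    accounts for the constant and Cauchy-Schwarz for the others.  This puts it
    in the candidate set as soon as [B * gap ^+ 2 <= alpha ^+ 2 * r / 4]
    ([flat_low_rank_candidate]); the largest such [B] is used.  The assumption
    that the rate exceeds [r * alpha ^+ 2 / minn d1 d2] makes this [B] fit in the
    shorter side.  A Gilbert-Varshamov code ([gilbert_varshamov]) gives
    exponentially many, in [n = maxn d1 d2 * B], arrays which differ in more than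
    [n / 8] cells, hence candidates whose normalized squared distance is at
    least [4 * rate]: no matrix is within [rate] of two of them ([cube_matrix_separated]).

    Information. All laws of the observations are compared with the law [p0]
    that belongs to the constant matrix [alpha - gap], in chi-square divergence.
    The shape of the links near [alpha] bounds the divergence of one entry by
    [2 * K * betap * gap ^+ 2] ([link_chi2_le]), and for independent entries the
    second moments of the likelihood ratios multiply ([product_chi2_le]).  For
    the rate of the theorem this second moment is at most a sixteenth of the number
    of candidates ([packing_parameters], [code_size_ge]).

    Test. If an estimator falls within [rate] of the candidate [z] with
    probability [g z c] when it sees the outcome [c], then [\sum_z g z c <= 1] by
    separation.  Cauchy-Schwarz against [p0] then shows that some candidate is
    found with probability at most 1/4 ([chi2_fano]).  This plays the role of
    Fano's inequality and involves finite sums only, since the observations take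
    finitely many values ([observations_prob]). *)

Set Implicit Arguments.
Unset Strict Implicit.
Unset Printing Implicit Defensive.
Import Order.TTheory GRing.Theory Num.Theory.
Import numFieldNormedType.Exports.
Local Open Scope classical_set_scope.
Local Open Scope ring_scope.

(** * Spectrum of a Gram matrix and the nuclear norm *)

Local Open Scope sesquilinear_scope.

Definition sqmod (R : rcfType) (z : R[i]) : R := complex.Re z ^+ 2 + complex.Im z ^+ 2.

Lemma sqmod_ge0 (R : rcfType) (z : R[i]) : 0 <= sqmod z.
Proof. by rewrite addr_ge0 ?sqr_ge0. Qed.

Lemma conjC_mul_sqmod (R : rcfType) (z : R[i]) : (z^* * z)%R = (sqmod z)%:C%C.
Proof.
case: z => a b; rewrite /sqmod /=.
by apply/eqP; rewrite eq_complex /=; apply/andP; split; apply/eqP; rewrite /=; ring.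
Qed.

Lemma adjoint_mul_diag (R : rcfType) (m n : nat) (B : 'M[R[i]]_(m, n)) i :
  (B ^t* *m B) i i = (\sum_k sqmod (B k i))%:C%C.
Proof.
rewrite mxE rmorph_sum; apply: eq_bigr => k _.
by rewrite !mxE conjC_mul_sqmod.
Qed.

(** The spectral theorem for the symmetric matrix A^T A is taken over the complex
    field: with a unitary [P] that diagonalizes it and [B = A P^*], the eigenvalue
    [t i] is the squared length of the column [i] of [B], which makes it real and
    nonnegative; the columns of [B] with nonzero length are independent.  In the
    last item [w i] is the squared modulus of the coordinate [i] of [P v]. *)
Lemma gram_spectrum (R : rcfType) (m n : nat) (A : 'M[R]_(m, n)) :
  exists t : 'I_n -> R, [/\ forall i, 0 <= t i,
    char_poly (A^T *m A) = \prod_i ('X - (t i)%:P),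
    (#|[pred i | (t i != 0)%R]| <= \rank A)%N,
    \sum_i t i = \sum_i \sum_j A i j ^+ 2 &
    forall v : 'cV[R]_n, exists w : 'I_n -> R, [/\ forall i, 0 <= w i,
      \sum_i w i = \sum_i v i 0 ^+ 2 &
      \sum_i w i * t i = \sum_i (A *m v) i 0 ^+ 2]].
Proof.
pose toC := real_complex R.
have tCr p q (X : 'M[R]_(p, q)) : (map_mx toC X) ^t* = map_mx toC X^T.
  by apply/matrixP => i j; rewrite !mxE conj_Creal // complex_real.
pose G := map_mx toC (A^T *m A); pose P := spectralmx G.
pose sp := spectral_diag G; pose B := map_mx toC A *m P ^t*.
have Pu : P \is unitarymx by exact: spectral_unitarymx.
have PPt : P *m P ^t* = 1%:M by exact/unitarymxP.
have PtP : P ^t* *m P = 1%:M by exact: mulmx1C PPt.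
have Gt : G ^t* = G by rewrite tCr trmx_mul trmxK.
have GE : G = P ^t* *m diag_mx sp *m P.
  rewrite -invmx_unitary //; apply/orthomx_spectralP.
  by apply/normalmxP; rewrite Gt.
have BB : B ^t* *m B = diag_mx sp.
  rewrite /B trmx_mul map_mxM -mulmxA (mulmxA _ (map_mx toC A)) tCr -map_mxM -/G.
  rewrite GE trmxCK !mulmxA PPt mul1mx.
  by rewrite -!mulmxA PPt mulmx1.
pose t i := \sum_k sqmod (B k i).
have spE i : sp 0 i = toC (t i).
  by have := adjoint_mul_diag B i; rewrite BB mxE eqxx.
exists t; split.
- by move=> i; apply: sumr_ge0 => k _; exact: sqmod_ge0.
- apply: (map_poly_inj toC).
  rewrite map_char_poly -/G.
  have -> : char_poly G = char_poly (diag_mx sp).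
    rewrite /char_poly /char_poly_mx.
    pose cP (X : 'M[R[i]]_n) := map_mx (@polyC _) X.
    have PPc : \det (cP P) * \det (cP (P ^t*)) = 1.
      by rewrite -det_mulmx -map_mxM PPt map_mx1 det1.
    have -> : 'X%:M - cP G = cP (P ^t*) *m ('X%:M - cP (diag_mx sp)) *m cP P.
      have eX : cP (P ^t*) *m 'X%:M *m cP P = 'X%:M.
        by rewrite scalar_mxC -mulmxA -map_mxM PtP map_mx1 mulmx1.
      by rewrite mulmxBr mulmxBl eX {1}GE /cP !map_mxM.
    by rewrite !det_mulmx mulrC mulrA PPc mul1r.
  rewrite char_poly_trig ?diag_mx_is_trig // rmorph_prod.
  by apply: eq_bigr => i _; rewrite mxE eqxx mulr1n spE rmorphB /= map_polyX map_polyC.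
- pose k := #|[pred i | t i != 0]|.
  pose f (i : 'I_k) : 'I_n := enum_val i.
  pose Bf := colsub f B.
  have BfE : Bf = B *m colsub f 1%:M by rewrite mulmx_colsub mulmx1.
  have : (\rank (Bf ^t* *m Bf) <= \rank A)%N.
    apply: leq_trans (mxrankM_maxr _ _) _.
    rewrite BfE; apply: leq_trans (mxrankM_maxl _ _) _.
    rewrite -(mxrank_map toC A); exact: mxrankM_maxl.
  have -> : Bf ^t* *m Bf = diag_mx (\row_i toC (t (f i))).
    apply/matrixP => i j.
    have -> : (Bf ^t* *m Bf) i j = (B ^t* *m B) (f i) (f j).
      by rewrite !mxE; apply: eq_bigr => l _; rewrite !mxE.
    by rewrite BB !mxE spE (inj_eq enum_val_inj).
  rewrite mxrank_unit // unitmxE det_diag unitfE; apply/prodf_neq0 => i _.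
  rewrite mxE; have := enum_valP i; rewrite inE => ti0.
  by apply: contra ti0 => /eqP /complexI ->.
- apply: complexI; rewrite rmorph_sum.
  transitivity (\tr G).
    rewrite GE mxtrace_mulC mulmxA PPt mul1mx; apply: eq_bigr => i _.
    by rewrite mxE eqxx mulr1n spE.
  rewrite exchange_big /= rmorph_sum.
  apply: eq_bigr => i _; rewrite !mxE; congr toC; apply: eq_bigr => j _.
  by rewrite mxE.
- move=> v; pose vc := P *m map_mx toC v.
  have vcE : vc ^t* *m vc = map_mx toC (v^T *m v).
    rewrite /vc trmx_mul map_mxM -mulmxA (mulmxA _ P).
    by rewrite PtP mul1mx tCr map_mxM.
  exists (fun i => sqmod (vc i 0)); split.
  + by move=> i; exact: sqmod_ge0.
  + apply: complexI; rewrite -adjoint_mul_diag vcE !mxE.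
    by congr toC; apply: eq_bigr => i _; rewrite mxE.
  + have GvE : vc ^t* *m diag_mx sp *m vc = map_mx toC ((A *m v)^T *m (A *m v)).
      rewrite /vc trmx_mul map_mxM; set vt := (_ ^t*).
      transitivity (vt *m (P ^t* *m diag_mx sp *m P) *m map_mx toC v).
        by rewrite !mulmxA.
      rewrite -GE /vt tCr /G.
      by rewrite trmx_mul !map_mxM !mulmxA.
    apply: complexI.
    transitivity (map_mx toC ((A *m v)^T *m (A *m v)) 0 0); last first.
      by rewrite mxE mxE; congr toC; apply: eq_bigr => i _; rewrite mxE.
    rewrite -GvE mxE rmorph_sum; apply: eq_bigr => i _.
    rewrite mul_mx_diag !mxE spE mulrAC conjC_mul_sqmod.
    exact: rmorphM.
Qed.

Local Close Scope sesquilinear_scope.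

(** Cauchy-Schwarz with weights: the right-hand side minus the left-hand side is
    the [f]-weighted variance of [a / f], up to a factor. *)
Lemma sqr_sum_le_weighted (R : realFieldType) (I : finType) (P : pred I) (f a : I -> R) :
  (forall i, P i -> 0 < f i) ->
  (\sum_(i | P i) a i) ^+ 2 <=
    (\sum_(i | P i) f i) * \sum_(i | P i) a i ^+ 2 / f i.
Proof.
move=> f0; set F := \sum_(i | P i) f i; set S := \sum_(i | P i) a i.
have [i0 Pi0|noP] := pickP P; last by rewrite /S big_pred0 // /F big_pred0 // mul0r expr0n.
have F0 : 0 < F.
  rewrite /F (bigD1 i0) //= ltr_pwDl ?f0 // sumr_ge0 // => i /andP[Pi _].
  exact: ltW (f0 _ Pi).
have : 0 <= \sum_(i | P i) (a i - f i * (S / F)) ^+ 2 / f i.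
  by apply: sumr_ge0 => i Pi; rewrite divr_ge0 ?sqr_ge0 // ltW // f0.
have -> : \sum_(i | P i) (a i - f i * (S / F)) ^+ 2 / f i =
    \sum_(i | P i) a i ^+ 2 / f i - S ^+ 2 / F.
  transitivity (\sum_(i | P i) (a i ^+ 2 / f i + (f i * (S / F) ^+ 2 - a i * (2 * (S / F))))).
    by apply: eq_bigr => i Pi; field; rewrite !gt_eqF ?f0.
  rewrite big_split /=; congr (_ + _).
  rewrite big_split /= sumrN -!mulr_suml -/F -/S.
  by field; rewrite gt_eqF.
by rewrite subr_ge0 ler_pdivrMr // mulrC.
Qed.

Lemma nuclear_norm_spectrum (R : realType) (m n : nat) (A : 'M[R]_(m, n))
    (t : 'I_n -> R) :
  char_poly (A^T *m A) = \prod_i ('X - (t i)%:P) ->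
  nuclear_norm A = \sum_i Num.sqrt (t i).
Proof.
move=> pE; rewrite /nuclear_norm; set p := char_poly _; set r := rootsR p.
pose s := [seq t i | i <- index_enum 'I_n].
have psE : p = \prod_(y <- s) ('X - y%:P) by rewrite /p pE big_map.
have p0 : p != 0 by rewrite monic_neq0 ?char_poly_monic.
have sr y : y \in s -> y \in r.
  move=> ys; have := roots_on_rootsR p0 y; rewrite in_itv /= => <-.
  by rewrite psE root_prod_XsubC.
have ur : uniq r by exact: uniq_roots.
transitivity (\sum_(x <- r) \sum_(y <- s | y == x) Num.sqrt y).
  apply: eq_bigr => x _; rewrite psE mu_prod_XsubC -big_filter.
  rewrite (eq_big_seq (fun=> Num.sqrt x)); last first.
    by move=> y; rewrite mem_filter => /andP[/eqP ->].
  by rewrite big_const_seq count_predT size_filter iter_addr_0.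
rewrite (exchange_big_dep xpredT) //= -[RHS](big_map t predT (fun y => Num.sqrt y)).
apply: eq_big_seq => y ys; rewrite big_mkcond (bigD1_seq y) ?sr //= eqxx.
by rewrite big1 ?addr0 // => x /negPf; rewrite eq_sym => ->.
Qed.

Lemma frobenius_sqr (R : realType) (m n : nat) (A : 'M[R]_(m, n)) :
  frobenius_norm A ^+ 2 = \sum_i \sum_j A i j ^+ 2.
Proof.
by rewrite sqr_sqrtr // sumr_ge0 // => i _; rewrite sumr_ge0 // => j _; exact: sqr_ge0.
Qed.

(** By Cauchy-Schwarz, the nonzero singular values other than the largest one add up
    to at most the square root of their number times their sum of squares, and the
    largest squared singular value is at least the Rayleigh quotient at [v].  When
    [A v] carries most of the norm of [A], this beats the usual bound
    [sqrt (rank A) * frobenius_norm A]. *)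
Lemma nuclear_norm_le (R : realType) (m n : nat) (A : 'M[R]_(m, n))
    (v : 'cV[R]_n) : \sum_i v i 0 ^+ 2 = 1 ->
  nuclear_norm A <= frobenius_norm A +
    Num.sqrt (\rank A)%:R *
    Num.sqrt (frobenius_norm A ^+ 2 - \sum_i (A *m v) i 0 ^+ 2).
Proof.
move=> v1; have [t [t0 /nuclear_norm_spectrum -> rk tr /(_ v)[w []]]] := gram_spectrum A.
move=> w0 w1 wt; rewrite v1 in w1.
have FE : frobenius_norm A ^+ 2 = \sum_i t i by rewrite frobenius_sqr tr.
case: n => [|n] in A v v1 t t0 rk tr w w0 w1 wt FE *.
  by move: v1; rewrite big_ord0 => /esym/eqP; rewrite oner_eq0.
have [j _ jmax] := @arg_maxP _ _ 'I_n.+1 ord0 xpredT t isT.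
rewrite FE -wt (bigD1 j) //=; apply: lerD.
  rewrite -(ler_pXn2r (n:=2)) ?nnegrE ?sqrtr_ge0 // FE sqr_sqrtr //.
  by rewrite (bigD1 j) //= lerDl sumr_ge0.
have wtj : \sum_i w i * t i <= t j.
  rewrite -[leRHS]mul1r -w1 mulr_suml; apply: ler_sum => i _.
  exact/ler_wpM2l/jmax.
pose Q := [pred i | (i != j) && (t i != 0)].
have -> : \sum_(i < n.+1 | i != j) Num.sqrt (t i) = \sum_(i | Q i) Num.sqrt (t i).
  rewrite (bigID (fun i => t i == 0)) /= big1 ?add0r //.
  by move=> i /andP[_ /eqP ->]; rewrite sqrtr0.
rewrite -(ler_pXn2r (n:=2)) ?nnegrE ?sqrtr_ge0 ?mulr_ge0 ?sqrtr_ge0 //; last first.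
  by rewrite sumr_ge0 // => i _; rewrite sqrtr_ge0.
have := @sqr_sum_le_weighted R _ Q (fun=> 1) (fun i => Num.sqrt (t i)) (fun _ _ => ltr01).
move/le_trans; apply.
rewrite sumr_const exprMn sqr_sqrtr ?ler0n // sqr_sqrtr; last first.
  rewrite subr_ge0 (le_trans wtj) // (bigD1 j) //= lerDl sumr_ge0 //.
apply: ler_pM => //.
- by rewrite sumr_ge0 // => i _; rewrite divr1 sqr_ge0.
- rewrite ler_nat (leq_trans _ rk) //; apply/subset_leq_card/fintype.subsetP => i.
  by rewrite !inE => /andP[].
rewrite lerBrDr.
apply: (@le_trans _ _ (\sum_(i | Q i) t i + t j)).
  by apply: lerD => //; apply: ler_sum => i _; rewrite divr1 sqr_sqrtr.
rewrite [leRHS](bigD1 j) //= [leLHS]addrC lerD2l.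
rewrite [leRHS](bigID (fun i => t i == 0)) /= lerDr sumr_ge0 //.
Qed.

(** * Codes with large Hamming distance *)

Definition hamming (T : finType) (x y : {ffun T -> bool}) : nat :=
  #|[pred i | x i != y i]|.

(** Each coordinate contributes 2 if it agrees with [x] and 1 otherwise, so that the
    sum factors into [#|T|] sums equal to 3. *)
Lemma sum_expn_hamming (T : finType) (x : {ffun T -> bool}) :
  (\sum_(y : {ffun T -> bool}) 2 ^ (#|T| - hamming x y) = 3 ^ #|T|)%N.
Proof.
transitivity (\sum_(y : {ffun T -> bool}) \prod_i (if x i == y i then 2 else 1))%N.
  apply: eq_bigr => y _; rewrite -big_mkcond /= prod_nat_const; congr (_ ^ _)%N.
  have <- := cardC [pred i | x i != y i]; rewrite addKn.
  by apply: eq_card => i; rewrite !inE negbK.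
rewrite -(bigA_distr_bigA (fun i b => if x i == b then 2 else 1)%N) /=.
rewrite -prod_nat_const; apply: eq_bigr => i _.
by rewrite big_bool; case: (x i).
Qed.

(** A Chernoff bound: every point of the ball weighs at least [2 ^ (#|T| - r)] in
    [sum_expn_hamming]. *)
Lemma card_hamming_ball (T : finType) (x : {ffun T -> bool}) (r : nat) :
  (#|[pred y | hamming x y <= r]| * 2 ^ (#|T| - r) <= 3 ^ #|T|)%N.
Proof.
rewrite -(sum_expn_hamming x) -sum_nat_const.
rewrite [leqRHS](bigID [pred y | hamming x y <= r]%N) /=.
apply: leq_trans (leq_addr _ _); apply: leq_sum => y yr.
by rewrite leq_exp2l // leq_sub2l.
Qed.

(** The balls of radius [n / 8] around the words of a maximal code cover the cube,
    and each holds at most [3 ^ n / 2 ^ (n - n / 8)] points.  The exponent 8 clears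
    the fraction, and [3 ^ 8 <= 2 ^ 13] turns the bound into a power of 2. *)
Lemma gilbert_varshamov (T : finType) :
  exists C : {set {ffun T -> bool}}, (2 ^ (2 * #|T|) <= #|C| ^ 8)%N /\
    {in C &, forall x y, x != y -> #|T| < 8 * hamming x y}%N.
Proof.
set n := #|T|.
pose code (C : {set {ffun T -> bool}}) :=
  [forall x in C, forall y in C, (x != y) ==> (n < 8 * hamming x y)%N].
have code0 : code finset.set0 by apply/forall_inP => x; rewrite inE.
have hC x y : hamming x y = hamming y x.
  by apply: eq_card => i; rewrite !inE eq_sym.
have [C codeC maxC] := @arg_maxnP _ finset.set0 code (fun C => #|C|) code0.
exists C; split; last first.
  move=> x y xC yC; move/forall_inP: codeC => /(_ x xC)/forall_inP/(_ y yC)/implyP.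
  exact.
have cover x : exists2 c, c \in C & (hamming c x <= n %/ 8)%N.
  apply: contrapT => far.
  have farx c : c \in C -> (n < 8 * hamming c x)%N.
    move=> cC; rewrite ltnNge; apply/negP => le; apply: far; exists c => //.
    by rewrite leq_divRL // mulnC.
  have xC : x \notin C.
    apply/negP => /farx; rewrite [hamming _ _]eq_card0 ?muln0 // => i.
    by rewrite !inE eqxx.
  (* [x] could be added to the code, against maximality. *)
  have : code (x |: C)%SET.
    apply/forall_inP => y /setU1P[->|yC]; apply/forall_inP => z /setU1P[->|zC];
      apply/implyP => yz.
    - by rewrite eqxx in yz.
    - by rewrite hC farx.
    - by rewrite farx.
    - by move/forall_inP: codeC => /(_ y yC)/forall_inP/(_ z zC)/implyP/(_ yz).
  by move=> /maxC /=; rewrite cardsU1 xC add1n ltnn.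
have vol : (2 ^ n * 2 ^ (n - n %/ 8) <= #|C| * 3 ^ n)%N.
  apply: (@leq_trans (\sum_(c in C) #|[pred y | hamming c y <= n %/ 8]| * 2 ^ (n - n %/ 8)))%N;
    last first.
    rewrite -sum_nat_const; apply: leq_sum => c _; exact: card_hamming_ball.
  rewrite -big_distrl /= leq_mul2r; apply/orP; right.
  have -> : (2 ^ n = \sum_(x : {ffun T -> bool}) 1)%N.
    by rewrite sum1_card card_ffun card_bool.
  rewrite (eq_bigr (fun c => \sum_(x : {ffun T -> bool}) (hamming c x <= n %/ 8 : nat)))%N;
    last first.
    by move=> c _; rewrite -sum1_card [LHS]big_mkcond.
  rewrite exchange_big /=; apply: leq_sum => x _.
  have [c cC cx] := cover x.
  by rewrite (bigD1 c) //= cx.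
have h8 := leq_exp2r (2 ^ n * 2 ^ (n - n %/ 8)) (#|C| * 3 ^ n) (isT : (0 < 8)%N).
move: vol; rewrite -h8 -expnD -!expnM expnMn -expnM => vol.
have e3 : (3 ^ (n * 8) <= 2 ^ (13 * n))%N.
  have e38 : (3 ^ 8 <= 2 ^ 13)%N by [].
  rewrite mulnC !expnM; case: (n) => [|k]; first by rewrite !expn0.
  by rewrite leq_exp2r.
rewrite -(leq_pmul2r (m := 2 ^ (13 * n))) ?expn_gt0 //.
apply: leq_trans (leq_trans vol _); last by rewrite leq_mul2l e3 orbT.
rewrite -expnD leq_exp2l //.
have arith q k : (q * 8 <= k -> 2 * k + 13 * k <= (k + (k - q)) * 8)%N.
  by clear; lia.
exact/arith/leq_divM.
Qed.

(** * A separated family of low-rank matrices *)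

(** There are [d %/ B] such indices at least, and [d <= 2 * B * (d %/ B)] because
    [B <= d]. *)
Lemma card_residue (d B : nat) (b : 'I_B) : (B <= d)%N ->
  (d <= 2 * B * #|[pred j : 'I_d | (j %% B)%N == b]|)%N.
Proof.
move=> Bd; have B0 : (0 < B)%N by case: (B) b => [[]|].
have qB : (d < (d %/ B).+1 * B)%N by exact: ltn_ceil.
have q0 : (0 < d %/ B)%N by rewrite divn_gt0.
apply: (@leq_trans (2 * B * (d %/ B))%N); first by nia.
rewrite leq_mul2l; apply/orP; right.
have lt (k : 'I_(d %/ B)) : (k * B + b < d)%N.
  have : (k.+1 * B <= (d %/ B) * B)%N by rewrite leq_mul2r ltn_ord orbT.
  by have := leq_divM d B; have := ltn_ord b; lia.
pose g k := Ordinal (lt k).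
have gI : injective g.
  move=> k k' /(congr1 val) /= /eqP; rewrite eqn_add2r eqn_pmul2r // => /eqP.
  exact: val_inj.
rewrite -[X in (X <= _)%N]card_ord -(card_codom gI).
apply/subset_leq_card/fintype.subsetP => _ /codomP[k ->].
by rewrite inE /= modnMDl modn_small.
Qed.

(** A layout assigns to each matrix entry one of the [maxn d1 d2 * B] cells of a
    binary array.  The fibers are large, so a change of one cell is visible in many
    entries; the rank bound keeps the matrices read off from such arrays simple. *)
Definition cell_layout (d1 d2 B : nat) (T : finType)
    (cell : 'I_d1 -> 'I_d2 -> T) : Prop :=
  [/\ #|T| = (maxn d1 d2 * B)%N,
      forall t, (minn d1 d2 <= 2 * B * #|[pred e | cell e.1 e.2 == t]|)%N &
      forall (F : fieldType) (h : T -> F),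
        (\rank (\matrix_(i, j) h (cell i j)) <= B)%N].

(** The column index is reduced modulo [B]: the matrix is then a product of a matrix
    with [B] columns and a 0-1 matrix that copies them. *)
Lemma cell_layout_tall (d1 d2 B : nat) : (0 < B <= d2)%N -> (d2 <= d1)%N ->
  exists (T : finType) (cell : 'I_d1 -> 'I_d2 -> T), cell_layout B cell.
Proof.
move=> /andP[B0 Bd2] d21.
pose res (j : 'I_d2) : 'I_B := Ordinal (ltn_pmod j B0).
exists ('I_d1 * 'I_B)%type, (fun i j => (i, res j)); split.
- by rewrite card_prod !card_ord (maxn_idPl d21).
- move=> [i b]; rewrite (minn_idPr d21); apply: leq_trans (card_residue b Bd2) _.
  rewrite leq_mul2l; apply/orP; right.
  have fI : injective (fun j : 'I_d2 => (i, j)) by move=> j j' [].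
  rewrite -(fintype.card_image fI);
  apply/subset_leq_card/fintype.subsetP => _ /fintype.imageP[j jb ->].
  by rewrite !inE /= xpair_eqE eqxx /= -val_eqE.
- move=> F h.
  have -> : (\matrix_(i < d1, j < d2) h (i, res j)) =
      (\matrix_(i < d1, b < B) h (i, b)) *m (\matrix_(b < B, j < d2) (b == res j)%:R).
    apply/matrixP => i j; rewrite !mxE (bigD1 (res j)) //= !mxE eqxx mulr1.
    by rewrite big1 ?addr0 // => b /negPf bj; rewrite !mxE bj mulr0.
  exact: leq_trans (mxrankM_maxl _ _) (rank_leq_col _).
Qed.

Lemma cell_layout_exists (d1 d2 B : nat) : (0 < B <= minn d1 d2)%N ->
  exists (T : finType) (cell : 'I_d1 -> 'I_d2 -> T), cell_layout B cell.
Proof.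
move=> /andP[B0]; rewrite leq_min => /andP[Bd1 Bd2].
have [d21|/ltnW d12] := leqP d2 d1; first by apply: cell_layout_tall; rewrite ?B0.
have [|T [cell [cT cfib crk]]] := @cell_layout_tall d2 d1 B _ d12; first by rewrite B0.
exists T, (fun i j => cell j i); split.
- by rewrite cT maxnC.
- move=> t; rewrite minnC; apply: leq_trans (cfib t) _.
  rewrite leq_mul2l; apply/orP; right.
  have sI : injective (fun e : 'I_d2 * 'I_d1 => (e.2, e.1)).
    by move=> [i j] [i' j'] [-> ->].
  rewrite -(fintype.card_image sI);
  apply/subset_leq_card/fintype.subsetP => _ /fintype.imageP[e et ->].
  exact: et.
- move=> F h; rewrite -mxrank_tr; apply: leq_trans (crk F h).
  rewrite leq_eqVlt; apply/orP; left; apply/eqP; congr mxrank.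
  by apply/matrixP => i j; rewrite !mxE.
Qed.

Definition cube_matrix (R : realType) (d1 d2 : nat) (T : finType)
    (cell : 'I_d1 -> 'I_d2 -> T) (top gap : R) (z : {ffun T -> bool}) :
    'M[R]_(d1, d2) :=
  \matrix_(i, j) (top - (z (cell i j))%:R * gap).

Lemma cube_matrix_dist (R : realType) (d1 d2 B : nat) (T : finType)
    (cell : 'I_d1 -> 'I_d2 -> T) (top gap : R) (x y : {ffun T -> bool}) :
  cell_layout B cell ->
  gap ^+ 2 * (hamming x y * minn d1 d2)%:R <=
  (2 * B)%:R * frobenius_norm (cube_matrix cell top gap x - cube_matrix cell top gap y) ^+ 2.
Proof.
move=> [_ fib _]; rewrite frobenius_sqr.
have -> : \sum_i \sum_j (cube_matrix cell top gap x - cube_matrix cell top gap y) i j ^+ 2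
    = gap ^+ 2 * (\sum_(e : 'I_d1 * 'I_d2)
        (x (cell e.1 e.2) != y (cell e.1 e.2) : nat))%:R.
  rewrite pair_bigA natr_sum mulr_sumr; apply: eq_bigr => -[i j] _ /=.
  rewrite !mxE; case: (x _); case: (y _) => /=; ring.
rewrite mulrCA ler_wpM2l ?sqr_ge0 // -natrM ler_nat.
rewrite (partition_big (fun e => cell e.1 e.2) xpredT) //= big_distrr /=.
rewrite /hamming -sum_nat_const [leqRHS](bigID (fun t => x t != y t)) /=.
apply: leq_trans (leq_addr _ _); apply: leq_sum => t xyt.
apply: leq_trans (fib t) _; rewrite leq_mul2l; apply/orP; right.
rewrite -sum1_card; apply: leq_sum => e /eqP ->.
by move: xyt; rewrite inE => ->.
Qed.

(** The mean minimizes the sum of squared deviations. *)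
Lemma mean_sqr_dev_le (R : realFieldType) (n : nat) (a : 'I_n -> R) (c : R) :
  (0 < n)%N ->
  \sum_j a j ^+ 2 - (\sum_j a j) ^+ 2 / n%:R <= \sum_j (a j - c) ^+ 2.
Proof.
move=> n0; have n0' : n%:R != 0 :> R by rewrite pnatr_eq0 -lt0n.
set S := \sum_j a j.
have -> : \sum_j (a j - c) ^+ 2 = \sum_j a j ^+ 2 - S ^+ 2 / n%:R + (S - n%:R * c) ^+ 2 / n%:R.
  transitivity (\sum_j (a j ^+ 2 + (- (2 * c) * a j + c ^+ 2))).
    by apply: eq_bigr => j _; ring.
  rewrite !big_split /= -mulr_sumr sumr_const card_ord -/S -[_ *+ n]mulr_natl.
  by field.
by rewrite lerDl divr_ge0 ?sqr_ge0.
Qed.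

(** [nuclear_norm_le] is used at the unit vector with constant coordinates: the norm
    left over is the deviation of the rows from their means, of order [gap].  The
    constant part costs [alpha * sqrt (d1 * d2)], which is half of the budget
    because [2 <= sqrt r], and the hypothesis on [B] gives the other half to the
    deviations. *)
Lemma flat_low_rank_candidate (R : realType) (d1 d2 B : nat) (alpha gap r : R)
    (X : 'M[R]_(d1, d2)) :
  (0 < d2)%N -> 1 <= alpha -> gap <= 1 -> 4 <= r ->
  B%:R * gap ^+ 2 <= alpha ^+ 2 * r / 4 ->
  (\rank X <= B)%N -> (forall i j, alpha - gap <= X i j <= alpha) ->
  candidate_set alpha r X.
Proof.
move=> d20 alpha1 gap1 r4 Bgap rX Xb; split; last first.
  by move=> i j; have /andP[X1 X2] := Xb i j; apply/andP; split => //; lra.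
have sd : Num.sqrt (d2%:R : R) ^+ 2 = d2%:R by rewrite sqr_sqrtr.
have d2R : 0 < d2%:R :> R by rewrite ltr0n.
pose v : 'cV[R]_d2 := const_mx (Num.sqrt d2%:R)^-1.
have v1 : \sum_i v i 0 ^+ 2 = 1.
  rewrite (eq_bigr (fun=> d2%:R^-1)); last by move=> i _; rewrite mxE exprVn sd.
  by rewrite sumr_const card_ord -[_ *+ d2]mulr_natl mulfV // gt_eqF.
apply: le_trans (nuclear_norm_le X v1) _.
have dd0 : 0 <= d1%:R * d2%:R :> R by rewrite mulr_ge0.
have FX : frobenius_norm X <= alpha * Num.sqrt (d1%:R * d2%:R).
  rewrite -(ler_pXn2r (n:=2)) ?nnegrE ?sqrtr_ge0 ?mulr_ge0 ?sqrtr_ge0 //; last lra.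
  rewrite frobenius_sqr exprMn sqr_sqrtr //.
  apply: (@le_trans _ _ (\sum_(i < d1) \sum_(j < d2) alpha ^+ 2)).
    apply: ler_sum => i _; apply: ler_sum => j _.
    have /andP[X1 X2] := Xb i j; nra.
  by rewrite !sumr_const !card_ord -!mulrnA -[_ *+ _]mulr_natr natrM [d2%:R * _]mulrC.
have dev : frobenius_norm X ^+ 2 - \sum_i (X *m v) i 0 ^+ 2 <= gap ^+ 2 * (d1%:R * d2%:R).
  rewrite frobenius_sqr -sumrB.
  apply: (@le_trans _ _ (\sum_(i < d1) \sum_(j < d2) gap ^+ 2)); last first.
    by rewrite !sumr_const !card_ord -!mulrnA -[_ *+ _]mulr_natr natrM [d2%:R * _]mulrC.
  apply: ler_sum => i _.
  have -> : (X *m v) i 0 ^+ 2 = (\sum_j X i j) ^+ 2 / d2%:R.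
    rewrite mxE (eq_bigr (fun j => X i j * (Num.sqrt d2%:R)^-1)); last first.
      by move=> j _; rewrite mxE.
    by rewrite -mulr_suml exprMn exprVn sd.
  apply: le_trans (mean_sqr_dev_le _ alpha d20) _; apply: ler_sum => j _.
  have /andP[X1 X2] := Xb i j; nra.
have -> : r * d1%:R * d2%:R = r * (d1%:R * d2%:R) by rewrite mulrA.
rewrite sqrtrM; last lra.
set s := Num.sqrt (d1%:R * d2%:R) in FX *.
have s0 : 0 <= s by exact: sqrtr_ge0.
have sr : 2 <= Num.sqrt r.
  have -> : 2 = Num.sqrt (2 ^+ 2) :> R by rewrite sqrtr_sqr ger0_norm.
  by apply: ler_wsqrtr; rewrite -natrX.
have snd : Num.sqrt (\rank X)%:R *
    Num.sqrt (frobenius_norm X ^+ 2 - \sum_i (X *m v) i 0 ^+ 2) <=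
    alpha * Num.sqrt r / 2 * s.
  rewrite -sqrtrM ?ler0n //.
  have -> : alpha * Num.sqrt r / 2 * s = Num.sqrt (alpha ^+ 2 * r / 4 * (d1%:R * d2%:R)).
    have -> : alpha ^+ 2 * r / 4 * (d1%:R * d2%:R) =
        (alpha / 2) ^+ 2 * (r * (d1%:R * d2%:R)) by field.
    rewrite sqrtrM ?sqr_ge0 // sqrtr_sqr ger0_norm; last lra.
    rewrite sqrtrM; last lra.
    by rewrite -/s; field.
  apply: ler_wsqrtr.
  apply: (@le_trans _ _ (B%:R * (gap ^+ 2 * (d1%:R * d2%:R)))).
    have rB : (\rank X)%:R <= B%:R :> R by rewrite ler_nat.
    apply: (@le_trans _ _ ((\rank X)%:R * (gap ^+ 2 * (d1%:R * d2%:R)))).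
      by rewrite ler_wpM2l.
    by rewrite ler_wpM2r // mulr_ge0 ?sqr_ge0.
  by rewrite mulrA ler_wpM2r.
apply: le_trans (lerD FX snd) _.
rewrite -mulrDl mulrA ler_wpM2r // -mulrA; nra.
Qed.

Lemma frobenius_sub_le (R : realType) (m n : nat) (X Y W : 'M[R]_(m, n)) :
  frobenius_norm (X - Y) ^+ 2 <=
    2 * frobenius_norm (X - W) ^+ 2 + 2 * frobenius_norm (Y - W) ^+ 2.
Proof.
rewrite !frobenius_sqr !mulr_sumr -big_split; apply: ler_sum => i _ /=.
rewrite !mulr_sumr -big_split; apply: ler_sum => j _ /=.
rewrite !mxE -subr_ge0.
have := sqr_ge0 (X i j - W i j + (Y i j - W i j)); lra.
Qed.

Lemma muln_max_min (m n : nat) : (maxn m n * minn m n = m * n)%N.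
Proof. by rewrite /maxn /minn; case: ltnP => // _; rewrite mulnC. Qed.

(** More than an eighth of the [maxn d1 d2 * B] cells differ, and each of them changes
    at least [minn d1 d2 / (2 * B)] entries by [gap]; hence the squared distance of
    the two matrices is at least [4 * rate * d1 * d2], and the parallelogram
    inequality [frobenius_sub_le] leaves no room for a common neighbour [W]. *)
Lemma cube_matrix_separated (R : realType) (d1 d2 B : nat) (T : finType)
    (cell : 'I_d1 -> 'I_d2 -> T) (top gap rate : R) (x y : {ffun T -> bool})
    (W : 'M[R]_(d1, d2)) :
  (0 < d1)%N -> (0 < d2)%N -> (0 < B)%N -> gap ^+ 2 = 64 * rate -> 0 < rate ->
  cell_layout B cell -> (#|T| < 8 * hamming x y)%N ->
  frobenius_norm (cube_matrix cell top gap x - W) ^+ 2 / (d1%:R * d2%:R) < rate ->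
  rate <= frobenius_norm (cube_matrix cell top gap y - W) ^+ 2 / (d1%:R * d2%:R).
Proof.
move=> d10 d20 B0 gapE rate0 layout far near_x.
set X := cube_matrix _ _ _ x in near_x *; set Y := cube_matrix _ _ _ y.
have dd0 : 0 < d1%:R * d2%:R :> R by rewrite mulr_gt0 ?ltr0n.
have par := frobenius_sub_le X Y W.
have := cube_matrix_dist top gap x y layout; rewrite -/X -/Y gapE.
have [cT _ _] := layout.
have hd : 64 * rate * (hamming x y * minn d1 d2)%:R >= 8 * rate * (B%:R * (d1%:R * d2%:R)).
  have -> : 64 * rate * (hamming x y * minn d1 d2)%:R =
      8 * rate * (8 * hamming x y * minn d1 d2)%:R by rewrite !natrM; ring.
  rewrite -!natrM ler_pM2l ?mulr_gt0 // ler_nat.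
  apply: (@leq_trans (#|T| * minn d1 d2)); last by rewrite leq_mul2r (ltnW far) orbT.
  by rewrite cT -mulnA [leqRHS]mulnCA muln_max_min.
move=> /(le_trans hd); rewrite natrM.
have -> : 8 * rate * (B%:R * (d1%:R * d2%:R)) = 2 * B%:R * (4 * rate * (d1%:R * d2%:R)) by ring.
rewrite ler_pM2l ?mulr_gt0 ?ltr0n // => /le_trans /(_ par).
move: near_x; rewrite ltr_pdivrMr // ler_pdivlMr //; lra.
Qed.

Lemma packing_family (R : realType) (d1 d2 B : nat) (alpha gap r rate : R) :
  (0 < d1)%N -> (0 < d2)%N -> 1 <= alpha -> 0 <= gap <= 1 / 4 -> 4 <= r ->
  0 < rate -> gap ^+ 2 = 64 * rate ->
  (0 < B <= minn d1 d2)%N -> B%:R * gap ^+ 2 <= alpha ^+ 2 * r / 4 ->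
  exists (I : finType) (C : {set I}) (X : I -> 'M[R]_(d1, d2)),
    [/\ (2 ^ (2 * (maxn d1 d2 * B)) <= #|C| ^ 8)%N,
        forall z, candidate_set alpha r (X z),
        forall z i j, alpha - gap <= X z i j <= alpha &
        {in C &, forall x y W, x != y ->
          frobenius_norm (X x - W) ^+ 2 / (d1%:R * d2%:R) < rate ->
          rate <= frobenius_norm (X y - W) ^+ 2 / (d1%:R * d2%:R)}].
Proof.
move=> d10 d20 alpha1 /andP[gap0 gap4] r4 rate0 gapE Bmin Bgap.
have [T [cell layout]] := cell_layout_exists Bmin.
have [cT _ crk] := layout.
have [C [sizeC sepC]] := gilbert_varshamov T.
have range (z : {ffun T -> bool}) i j :
    alpha - gap <= cube_matrix cell alpha gap z i j <= alpha.
  by rewrite mxE; case: (z _); rewrite ?mul1r ?mul0r ?subr0 ?lexx ?gerBl ?gap0.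
exists {ffun T -> bool}, C, (cube_matrix cell alpha gap); split=> //.
- by rewrite -cT.
- move=> z; apply: (flat_low_rank_candidate (B := B) (gap := gap)) => //.
    by apply: le_trans gap4 _; lra.
  exact: (crk _ (fun t => alpha - (z t)%:R * gap)).
- move=> x y xC yC W xy.
  apply: (cube_matrix_separated (B := B)) => //; last exact: sepC.
  by case/andP: Bmin.
Qed.

(** * Testing in chi-square divergence *)

(** A substitute for Fano's inequality.  Here [g i z] is the probability of deciding
    for [i] after the outcome [z].  If every decision were right with probability
    more than 1/4, the sum of these probabilities would exceed [#|C| / 4]; but each
    term [p i z * g i z] is split by the inequality of arithmetic and geometric
    means into a part controlled by the second moment [S] of the likelihood ratio
    and a part [p0 z * g i z], whose sum over [i] and [z] is at most 1. *)
Lemma chi2_fano (R : realFieldType) (I Z : finType) (C : {set I})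
    (p0 : Z -> R) (p g : I -> Z -> R) (S : R) :
  (forall z, 0 < p0 z) -> \sum_z p0 z = 1 ->
  {in C, forall i, \sum_z p i z ^+ 2 / p0 z <= S} ->
  16 * S <= #|C|%:R -> (0 < #|C|)%N ->
  (forall i z, 0 <= g i z) -> (forall z, \sum_(i in C) g i z <= 1) ->
  exists2 i, i \in C & \sum_z p i z * g i z <= 1 / 4.
Proof.
move=> p00 p01 pS SN N0 g0 g1; apply: contrapT => H.
have {}H i : i \in C -> 1 / 4 < \sum_z p i z * g i z.
  by move=> iC; rewrite ltNge; apply/negP => ?; apply: H; exists i.
set N := #|C|%:R : R in SN *.
have {}N0 : 0 < N by rewrite ltr0n.
have : N / 4 < \sum_(i in C) \sum_z p i z * g i z.
  have [i0 i0C] : exists i, i \in C by apply/set0Pn; rewrite -card_gt0 -(ltr0n R).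
  have -> : N / 4 = \sum_(i in C) (1 / 4) by rewrite sumr_const -[RHS]mulr_natl mul1r.
  by apply: ltr_sum => //; apply/hasP; exists i0; rewrite ?mem_index_enum.
rewrite ltNge => /negP; apply.
have amgm i z : i \in C -> p i z * g i z <=
    2 / N * (p i z ^+ 2 / p0 z) + N / 8 * (p0 z * g i z).
  move=> iC; have gi1 : g i z <= 1.
    by apply: le_trans (g1 z); rewrite (bigD1 i) //= lerDl sumr_ge0.
  (* The weight 4 / N balances the two parts, which then sum to at most N / 8 each. *)
  have : 0 <= 2 / (N * p0 z) * (p i z - N / 4 * (p0 z * g i z)) ^+ 2.
    by rewrite mulr_ge0 ?sqr_ge0 // divr_ge0 ?mulr_ge0 // ltW.
  have -> : 2 / (N * p0 z) * (p i z - N / 4 * (p0 z * g i z)) ^+ 2 =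
     2 / N * (p i z ^+ 2 / p0 z) - p i z * g i z + N / 8 * (p0 z * g i z ^+ 2).
    by field; rewrite !gt_eqF.
  have : N / 8 * (p0 z * g i z ^+ 2) <= N / 8 * (p0 z * g i z).
    by rewrite ler_pM2l ?divr_gt0 // ler_pM2l // expr2 ler_piMl.
  lra.
apply: (@le_trans _ _ (\sum_(i in C) (2 / N * S) + N / 8 * 1)); last first.
  rewrite sumr_const -[_ *+ #|C|]mulr_natl -/N.
  have -> : N * (2 / N * S) = 2 * S by field; rewrite gt_eqF.
  lra.
rewrite -[X in _ + _ * X]p01 mulr_sumr.
apply: (@le_trans _ _ (\sum_(i in C)
    (2 / N * S + \sum_z N / 8 * (p0 z * g i z)))).
  apply: ler_sum => i iC.
  apply: (@le_trans _ _ (2 / N * (\sum_z p i z ^+ 2 / p0 z) +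
      \sum_z N / 8 * (p0 z * g i z))).
    rewrite mulr_sumr -big_split /=; apply: ler_sum => z _; exact: amgm.
  by rewrite lerD2r ler_pM2l ?pS // divr_gt0.
rewrite big_split /= lerD2l exchange_big /=; apply: ler_sum => z _.
by rewrite -!mulr_sumr ler_pM2l ?divr_gt0 // ler_piMr // ltW.
Qed.

(** The second moment of the likelihood ratio of product laws is the product of the
    second moments of the factors. *)
Lemma product_chi2_le (R : realType) (E J : finType) (w w0 : E -> J -> R) (s : R) :
  (forall e j, 0 < w0 e j) ->
  (forall e, \sum_j w e j ^+ 2 / w0 e j <= 1 + s) ->
  \sum_(c : {ffun E -> J}) (\prod_e w e (c e)) ^+ 2 / \prod_e w0 e (c e) <=
    expR (s * #|E|%:R).
Proof.
move=> w00 ws.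
rewrite (eq_bigr (fun c : {ffun E -> J} => \prod_e (w e (c e) ^+ 2 / w0 e (c e)))); last first.
  by move=> c _; rewrite prodf_div prodrXl.
rewrite -(bigA_distr_bigA (fun e j => w e j ^+ 2 / w0 e j)) /=.
rewrite mulrC expRM_natl -prodr_const; apply: ler_prod => e _.
apply/andP; split; first by apply: sumr_ge0 => j _; rewrite divr_ge0 ?sqr_ge0 // ltW.
exact: le_trans (ws e) (expR_ge1Dx s).
Qed.

(** * Divergence of the link functions *)

(** The mean value theorem gives a point [c] of [y, x] with slope
    [g' y <= g' c <= 0]: the slope at the left end has the largest modulus. *)
Lemma sqr_diff_le (R : realType) (g : R -> R) (a b x y : R) :
  (forall z : R, derivable g z 1) ->
  {in `[a, b] &, forall u v : R, u <= v -> g v <= g u} ->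
  {in `[a, b] &, forall u v : R, u <= v ->
     g^`()%classic u <= g^`()%classic v} ->
  x \in `[a, b] -> y \in `[a, b] -> y <= x ->
  (g x - g y) ^+ 2 <= g^`()%classic y ^+ 2 * (x - y) ^+ 2.
Proof.
move=> dg decg incg xab yab; rewrite le_eqVlt => /predU1P[->|yx].
  by rewrite !subrr !expr0n mulr0.
have [c cyx gE] : exists2 c, c \in `]y, x[ & g x - g y = g^`()%classic c * (x - y).
  apply: MVT => //.
    by move=> z _; rewrite derive1E; apply: DeriveDef.
  by apply: derivable_within_continuous => z _; exact: dg.
have cab : c \in `[a, b].
  move: cyx xab yab; rewrite !in_itv /= => /andP[yc cx] /andP[_ xb] /andP[ay _].
  by apply/andP; split; [exact: le_trans (ltW yc)|exact: le_trans (ltW cx) _].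
have yc : y <= c by move: cyx; rewrite in_itv => /andP[/ltW].
have c0 : g^`()%classic c <= 0.
  have : g x - g y <= 0 by rewrite subr_le0; apply: decg => //; exact: ltW.
  by rewrite gE pmulr_lle0 // subr_gt0.
have ycd := incg _ _ yab cab yc.
have : (- g^`()%classic c) ^+ 2 <= (- g^`()%classic y) ^+ 2.
  by rewrite ler_pXn2r ?nnegrE ?oppr_ge0 ?lerN2 ?(le_trans ycd c0).
by rewrite !sqrrN gE exprMn => ?; rewrite ler_wpM2r ?sqr_ge0.
Qed.

(** The sum is 1 plus the chi-square divergence of the laws at [x] and [y].  For the
    categories other than the last, [sqr_diff_le] bounds the increments by the
    derivative at the left end [y], where [link_beta] controls its square over
    [f k y].  The increment of the last category is minus the sum of the others;
    since its probability exceeds 1/2, Cauchy-Schwarz with the weights [f k y]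
    bounds its term by the sum of the other terms, whence the factor 2. *)
Lemma link_chi2_le (R : realType) (K : nat) (alpha : R) (f : 'I_K -> R -> R)
    (L betam betap : R) :
  1 <= alpha -> link_functions alpha f L betam betap ->
  (forall k : 'I_K, (k.+1 < K)%N ->
    {in `[alpha - 1 / 4, alpha] &, forall x y : R, x <= y -> f k y <= f k x} /\
    {in `[alpha - 1 / 4, alpha] &, forall x y : R, x <= y ->
       (f k)^`()%classic x <= (f k)^`()%classic y}) ->
  (forall k : 'I_K, k.+1 = K -> 1 / 2 < f k (alpha - 1 / 4)) ->
  {in `[alpha - 1 / 4, alpha] &, forall x y : R, y <= x ->
    \sum_k f k x ^+ 2 / f k y <= 1 + 2 * K%:R * betap * (x - y) ^+ 2}.
Proof.
move=> alpha1 [df f1 f0 _ _ bp0 _ _ bp] mono last x y xI yI yx.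
have sub z : z \in `[alpha - 1 / 4, alpha] -> z \in `[- alpha, alpha].
  by rewrite !in_itv /= => /andP[z1 z2]; apply/andP; split => //; lra.
have aI : alpha - 1 / 4 \in `[alpha - 1 / 4, alpha].
  by rewrite in_itv /=; apply/andP; split => //; lra.
case: K => [|K] in f df f1 f0 bp mono last *.
  by have := f1 _ (sub _ aI); rewrite big_ord0 => /esym/eqP; rewrite oner_eq0.
have f0y k : 0 < f k y by apply: f0; exact: sub.
pose D k := f k x - f k y; pose l := @ord_max K.
have lastP k : k != l -> (k.+1 < K.+1)%N.
  by rewrite -val_eqE /= ltnS => kl; rewrite ltn_neqAle kl -ltnS ltn_ord.
have SD : \sum_k D k = 0 by rewrite sumrB !f1 ?subrr // sub.
have -> : \sum_k f k x ^+ 2 / f k y = 1 + \sum_k D k ^+ 2 / f k y.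
  transitivity (\sum_k (f k y + (2 * D k + D k ^+ 2 / f k y))).
    by apply: eq_bigr => k _; rewrite /D; field; rewrite gt_eqF.
  by rewrite !big_split /= -mulr_sumr SD f1 ?sub // mulr0 add0r.
rewrite lerD2l (bigD1 l) //=.
set chi := \sum_(k | _) _.
have fl2 : 1 / 2 < f l y.
  apply: (lt_le_trans (last l erefl)).
  have := f1 _ (sub _ aI); have := f1 _ (sub _ yI).
  rewrite !(bigD1 (P := predT) l) //= => e1 e2.
  have : \sum_(k | k != l) f k y <= \sum_(k | k != l) f k (alpha - 1 / 4).
    apply: ler_sum => k /lastP kl; apply: (mono k kl).1 => //.
    by move: yI; rewrite in_itv => /andP[].
  lra.
have chi0 : 0 <= chi.
  by apply: sumr_ge0 => k _; rewrite divr_ge0 ?sqr_ge0 // ltW.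
have Dl : D l ^+ 2 / f l y <= chi.
  have := @sqr_sum_le_weighted R _ (fun k => k != l) (fun k => f k y) D (fun k _ => f0y k).
  move: SD; rewrite (bigD1 l) //= addrC => /eqP; rewrite addr_eq0 => /eqP ->.
  have := f1 _ (sub _ yI); rewrite (bigD1 l) //= => e1.
  rewrite sqrrN -/chi => le; rewrite ler_pdivrMr //; apply: (le_trans le).
  rewrite mulrC ler_wpM2l //; lra.
have chiK : chi <= K.+1%:R * (betap * (x - y) ^+ 2).
  apply: (@le_trans _ _ (\sum_(k < K.+1) betap * (x - y) ^+ 2)); last first.
    by rewrite sumr_const card_ord mulr_natl.
  rewrite [leRHS](bigD1 l) //= ler_wpDl //; first by
    apply: mulr_ge0; [exact: ltW|exact: sqr_ge0].
  apply: ler_sum => k kl; have [m1 m2] := mono k (lastP k kl).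
  rewrite ler_pdivrMr //.
  apply: (le_trans (sqr_diff_le (df k) m1 m2 xI yI yx)).
  rewrite [leRHS]mulrAC ler_wpM2r ?sqr_ge0 // -ler_pdivrMr //.
  apply: (@le_trans _ _ (link_beta f y)).
    by rewrite /link_beta; exact: (le_bigmax 0 (fun k => (f k)^`()%classic y ^+ 2 / f k y) k).
  rewrite -lee_fin; apply: le_trans bp; apply: ereal_sup_ubound.
  by exists y => //=; exact: sub.
apply: le_trans (lerD Dl chiK) _.
apply: le_trans (lerD chiK (lexx _)) _.
by rewrite le_eqVlt; apply/orP; left; apply/eqP; ring.
Qed.

(** * Probability of an event of the observations and the seed *)

Lemma measure_finType_bigcup (R : realType) (d : measure_display)
    (T : measurableType d) (mu : {measure set T -> \bar R}) (I : finType)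
    (P : {pred I}) (F : I -> set T) :
  trivIset [set` P] F -> (forall i, P i -> measurable (F i)) ->
  (mu (\bigcup_(i in [set` P]) F i) = \sum_(i in P) mu (F i))%E.
Proof.
move=> tF mF; rewrite measure_fin_bigcup //.
by apply/esym/bigfs => [|i _]; rewrite ?index_enum_uniq ?mem_index_enum.
Qed.

(** Every observation vector is [a \o c] for a unique [c], so the event is the finite
    disjoint union of rectangles, a value of the observations times a seed event,
    and independence gives the probability of each value. *)
Lemma observations_prob (R : realType) (d1 d2 K : nat) (f : 'I_K -> R -> R)
    (A : Type) (a : 'I_K -> A) (Omega : {set 'I_d1 * 'I_d2})
    (M : 'M[R]_(d1, d2)) (dT : measure_display) (T : measurableType dT)
    (P : probability T R) (Y : {e | e \in Omega} -> T -> A)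
    (dU : measure_display) (U : measurableType dU) (Q : probability U R)
    (H : ({e | e \in Omega} -> A) -> set U) :
  injective a -> observations f a M P Y -> (forall y, measurable (H y)) ->
  ((P \x Q) [set tu | H (fun e => Y e tu.1) tu.2] =
   (\sum_(c : {ffun {e | e \in Omega} -> 'I_K})
     (\prod_e f (c e) (M (val e).1 (val e).2)) * fine (Q (H (a \o c))))%:E)%E.
Proof.
move=> aI [rangeY measY lawY indepY] mH.
pose F (c : {ffun {e | e \in Omega} -> 'I_K}) :=
  [set t | forall e, Y e t = a (c e)].
have mF c : measurable (F c).
  have -> : F c = \bigcap_(e in [set: {e | e \in Omega}]) (Y e @^-1` [set a (c e)]).
    by apply/seteqP; split=> [t Ft e _|t Ft e]; [exact: Ft|exact: (Ft e I)].
  by apply: fin_bigcap_measurable => // e _; exact: measY.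
have -> : [set tu | H (fun e => Y e tu.1) tu.2] =
    \bigcup_(c in [set` predT]) (F c `*` H (a \o c)).
  apply/seteqP; split=> [[t u] /= Htu|[t u] [c _ [/= Fc Hu]]]; last first.
    by rewrite (_ : (fun e => Y e t) = a \o c) //; apply/funext => e; exact: Fc.
  have /choice[c cE] : forall e, exists k, a k = Y e t.
    by move=> e; have [k _ kE] := rangeY e t; exists k.
  exists [ffun e => c e] => //; split => /=.
    by move=> e; rewrite ffunE cE.
  rewrite (_ : a \o _ = fun e => Y e t) //; apply/funext => e /=.
  by rewrite ffunE cE.
rewrite measure_finType_bigcup; last first.
- by move=> c _; exact: measurableX.
- move=> c c' _ _ [[t u] [[/= Fc _] [/= Fc' _]]]; apply/ffunP => e.
  by apply: aI; rewrite -Fc -Fc'.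
rewrite -sumEFin; apply: eq_bigr => c _.
transitivity (P (F c) * Q (H (a \o c)))%E; first exact: product_measure1E.
rewrite EFinM fineK ?fin_num_measure //; congr (_ * _)%E.
rewrite (indepY (fun e => [set a (c e)])) (big_morph EFin (@EFinM R) erefl).
by apply: eq_bigr => e _; exact: lawY.
Qed.

Lemma measurable_frobenius_ge (R : realType) (m n : nat) (X : 'M[R]_(m, n))
    (c rate : R) (dU : measure_display) (U : measurableType dU)
    (h : U -> 'M[R]_(m, n)) :
  (forall i j, measurable_fun [set: U] (fun u => h u i j)) ->
  measurable [set u | rate <= frobenius_norm (X - h u) ^+ 2 / c].
Proof.
move=> mh; pose dist u := (\sum_i \sum_j (X i j - h u i j) ^+ 2) / c.
have -> : [set u | rate <= frobenius_norm (X - h u) ^+ 2 / c] =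
    [set: U] `&` dist @^-1` [set` `[rate, +oo[].
  rewrite setTI; apply/seteqP; split=> u /=; rewrite in_itv /= andbT frobenius_sqr;
    by under eq_bigr do under eq_bigr do rewrite !mxE.
have : measurable_fun [set: U] dist; last by apply.
apply: measurable_funM => //; apply: measurable_sum => i; apply: measurable_sum => j.
by apply: measurable_funX; exact: measurable_funB.
Qed.

(** * The lower bound *)

(** For each outcome, the seed events on which the estimate is close to [X z], for [z]
    in [C], are disjoint by separation: their probabilities are a randomized
    decision rule, to which [chi2_fano] applies with the law of the constant matrix
    [alpha - gap] as reference. *)
Lemma estimation_lower_bound (R : realType) (d1 d2 K : nat) (alpha : R)
    (f : 'I_K -> R -> R) (L betam betap gap rate : R)
    (A : Type) (a : 'I_K -> A) (Omega : {set 'I_d1 * 'I_d2})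
    (dU : measure_display) (U : measurableType dU) (Q : probability U R)
    (Mhat : U -> ({e | e \in Omega} -> A) -> 'M[R]_(d1, d2))
    (I : finType) (C : {set I}) (X : I -> 'M[R]_(d1, d2)) :
  1 <= alpha -> 0 <= gap <= 1 / 4 -> link_functions alpha f L betam betap ->
  (forall k : 'I_K, (k.+1 < K)%N ->
    {in `[alpha - 1 / 4, alpha] &, forall x y : R, x <= y -> f k y <= f k x} /\
    {in `[alpha - 1 / 4, alpha] &, forall x y : R, x <= y ->
       (f k)^`()%classic x <= (f k)^`()%classic y}) ->
  (forall k : 'I_K, k.+1 = K -> 1 / 2 < f k (alpha - 1 / 4)) ->
  injective a ->
  (forall y i j, measurable_fun [set: U] (fun u => Mhat u y i j)) ->
  (forall z i j, alpha - gap <= X z i j <= alpha) ->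
  {in C &, forall x y W, x != y ->
    frobenius_norm (X x - W) ^+ 2 / (d1%:R * d2%:R) < rate ->
    rate <= frobenius_norm (X y - W) ^+ 2 / (d1%:R * d2%:R)} ->
  16 * expR (2 * K%:R * betap * gap ^+ 2 * #|Omega|%:R) <= #|C|%:R ->
  exists2 z, z \in C &
    forall (dT : measure_display) (T : measurableType dT)
      (P : probability T R) (Y : {e | e \in Omega} -> T -> A),
      observations f a (X z) P Y ->
      ((3 / 4)%:E <= (P \x Q)
         [set tu | (rate <=
            frobenius_norm (X z - Mhat tu.2 (fun e => Y e tu.1)) ^+ 2
              / (d1%:R * d2%:R))%R])%E.
Proof.
move=> alpha1 /andP[gap0 gap4] links mono last aI measMhat Xrange sepX sizeC.
have bp0 := link_betap_gt0 links.
set low := alpha - gap in Xrange.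
have near_alpha x : low <= x <= alpha -> x \in `[alpha - 1 / 4, alpha].
  rewrite in_itv /= => /andP[lx ->]; rewrite andbT; apply: le_trans lx.
  by rewrite lerD2l lerN2.
have link_dom x : low <= x <= alpha -> x \in `[- alpha, alpha].
  move=> /near_alpha; rewrite !in_itv /= => /andP[ax ->]; rewrite andbT.
  by apply: le_trans ax; clear -alpha1; lra.
have lowI : low <= low <= alpha by rewrite lexx gerBl.
pose E := {e | e \in Omega}.
pose p0 (c : {ffun E -> 'I_K}) := \prod_e f (c e) low.
pose p z (c : {ffun E -> 'I_K}) := \prod_e f (c e) (X z (val e).1 (val e).2).
pose good z (y : E -> A) :=
  [set u | rate <= frobenius_norm (X z - Mhat u y) ^+ 2 / (d1%:R * d2%:R)].
have mgood z y : measurable (good z y) by exact: measurable_frobenius_ge.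
pose fail z (c : {ffun E -> 'I_K}) := fine (Q (~` good z (a \o c))).
have sum_law (x : E -> R) : (forall e, low <= x e <= alpha) ->
    \sum_(c : {ffun E -> 'I_K}) \prod_e f (c e) (x e) = 1.
  move=> xI; rewrite -(bigA_distr_bigA (fun e k => f k (x e))) /=.
  by rewrite big1 // => e _; apply: (link_sum1 links); exact: link_dom.
have flow k : 0 < f k low by apply: (link_gt0 links); exact: link_dom.
have chi z : \sum_c p z c ^+ 2 / p0 c <=
    expR (2 * K%:R * betap * gap ^+ 2 * #|Omega|%:R).
  have -> : #|Omega| = #|{: E}| by rewrite card_sig.
  apply: (product_chi2_le (w := fun e k => f k (X z (val e).1 (val e).2))
    (w0 := fun e k => f k low)) => // e.
  have /andP[xlow xalpha] := Xrange z (val e).1 (val e).2.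
  apply: le_trans (link_chi2_le alpha1 links mono last (near_alpha _ (Xrange _ _ _))
    (near_alpha _ lowI) xlow) _.
  rewrite lerD2l ler_wpM2l //.
    by apply: mulr_ge0; [apply: mulr_ge0|exact: ltW].
  by rewrite lerXn2r ?nnegrE ?subr_ge0 // lerBlDr addrC subrK.
have C0 : (0 < #|C|)%N.
  by rewrite -(ltr0n R); apply: lt_le_trans sizeC; rewrite mulr_gt0 ?expR_gt0.
have fail_sum c : \sum_(z in C) fail z c <= 1.
  rewrite -lee_fin -sumEFin.
  rewrite (eq_bigr (fun z => Q (~` good z (a \o c)))); last first.
    by move=> z _; rewrite fineK ?fin_num_measure //; exact: measurableC.
  have mbad z : measurable (~` good z (a \o c)) by exact: measurableC.
  rewrite -(@measure_finType_bigcup _ _ _ Q _ (mem C)) //.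
    by apply: probability_le1; exact: fin_bigcup_measurable.
  move=> x y xC yC [u [/= xu yu]]; apply/eqP; apply: contrapT => /negP xy.
  by apply: yu; apply: sepX xy _ => //; rewrite ltNge; apply/negP.
have [z zC failz] : exists2 z, z \in C & \sum_c p z c * fail z c <= 1 / 4.
  apply: (chi2_fano (p0 := p0)) sizeC C0 _ _ => //.
  - by move=> c; apply: prodr_gt0.
  - exact: sum_law.
  - by move=> z c; exact: fine_ge0.
exists z => // dT T' P Y obs.
rewrite (observations_prob Q aI obs (mgood z)) lee_fin.
have p1 : \sum_c p z c = 1 by apply: sum_law => e; exact: Xrange.
rewrite (eq_bigr (fun c => p z c - p z c * fail z c)); last first.
  move=> c _; rewrite /fail probability_setC // fineB ?fin_num_measure //=.
  by rewrite mulrBr mulr1 opprB addrC subrK.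
by rewrite sumrB p1; clear -failz; lra.
Qed.

Lemma expR_half_le2 (R : realType) : expR (1 / 2) <= 2 :> R.
Proof.
have : 1 / 2 <= expR (- (1 / 2)) :> R by apply: le_trans (expR_ge1Dx _); lra.
rewrite expRN -[leRHS]div1r ler_pdivlMr ?expR_gt0 //; lra.
Qed.

(** Both factors of [(16 * expR t) ^+ 8] are at most [2 ^+ n]: the first because
    [16 ^ 8 = 2 ^ 32], the second because [8 * t <= n / 2] and [expR (1 / 2) <= 2]. *)
Lemma code_size_ge (R : realType) (N n : nat) (t : R) :
  (2 ^ (2 * n) <= N ^ 8)%N -> (32 <= n)%N -> 16 * t <= n%:R ->
  16 * expR t <= N%:R.
Proof.
move=> sizeN n32 tn.
rewrite -(ler_pXn2r (n := 8)) ?nnegrE ?ler0n ?mulr_ge0 ?expR_ge0 //.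
apply: (@le_trans _ _ (2 ^+ n * 2 ^+ n)); last first.
  by rewrite -exprD addnn -mul2n -!natrX ler_nat.
rewrite exprMn; apply: ler_pM; rewrite ?exprn_ge0 ?expR_ge0 //.
  have -> : 16 = 2 ^+ 4 :> R by ring.
  by rewrite -exprM ler_weXn2l ?ler1n.
rewrite -expRM_natl; apply: (@le_trans _ _ (expR (1 / 2) ^+ n)).
  rewrite -expRM_natl ler_expR; lra.
by rewrite lerXn2r ?nnegrE ?expR_ge0 // expR_half_le2.
Qed.

Lemma lower_rate_bounds (R : realType) (C1 C2 alpha r betap : R) (d1 d2 K m : nat) :
  lower_rate C1 C2 alpha r betap d1 d2 K m <= C1 /\
  ((0 < m)%N -> lower_rate C1 C2 alpha r betap d1 d2 K m <=
    C2 * (alpha / Num.sqrt (K%:R * betap) * Num.sqrt (r * (maxn d1 d2)%:R / m%:R))).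
Proof.
rewrite /lower_rate; case: m => [|m] /=; first by [].
by split=> [|_]; rewrite ge_min ?lexx // -(mulrA C2) lexx orbT.
Qed.

(** Here [g] stands for [gap ^+ 2], and [B] is the integer part of
    [b0 = alpha ^+ 2 * r / (4 * g)].  As [b0] is at least 16, [b0 <= 2 * B], so [maxn d1 d2 * B] is of order [alpha ^+ 2 * r * maxn d1 d2 / g];
    the last item then amounts to a bound on [g ^+ 2], which is the square of the
    hypothesis on [16 * g]. *)
Lemma packing_parameters (R : realType) (alpha r betap g : R) (d1 d2 K m : nat) :
  1 <= alpha -> (0 < d1)%N -> (0 < d2)%N -> 4 <= r ->
  16 <= alpha ^+ 2 * r * (maxn d1 d2)%:R -> 0 < betap -> 0 < g -> g <= 1 / 16 ->
  ((0 < m)%N -> 16 * g <=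
    alpha / Num.sqrt (K%:R * betap) * Num.sqrt (r * (maxn d1 d2)%:R / m%:R)) ->
  alpha ^+ 2 * r <= 4 * g * (minn d1 d2)%:R ->
  exists B : nat, [/\ (0 < B <= minn d1 d2)%N,
    B%:R * g <= alpha ^+ 2 * r / 4,
    (32 <= maxn d1 d2 * B)%N &
    16 * (2 * K%:R * betap * g * m%:R) <= (maxn d1 d2 * B)%:R].
Proof.
move=> alpha1 d10 d20 r4 large bp0 g0 g1 gx gmin.
set D := maxn d1 d2 in large gx *.
have ra0 : 4 <= alpha ^+ 2 * r by nra.
set w := alpha ^+ 2 * r in large gmin ra0 *.
have g4 : 0 < 4 * g by lra.
pose b0 := w / (4 * g).
have b0E : b0 * (4 * g) = w by rewrite divfK // gt_eqF.
have b016 : 16 <= b0 by rewrite ler_pdivlMr; lra.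
have /andP[Bb bB] : (Num.truncn b0)%:R <= b0 < (Num.truncn b0).+1%:R.
  by apply: truncn_itv; lra.
move: Bb bB; set B := Num.truncn b0; rewrite -natr1 => Bb bB.
have B0 : (0 < B)%N by rewrite -(ltr_nat R); lra.
have B1 : 1 <= B%:R :> R by rewrite ler1n.
have bB2 : b0 <= 2 * B%:R by lra.
have D0 : 0 <= D%:R :> R by rewrite ler0n.
have DB : w * D%:R <= 8 * g * (D * B)%:R.
  have -> : 8 * g * (D * B)%:R = 4 * g * (2 * B%:R * D%:R) by rewrite natrM; ring.
  have -> : w * D%:R = 4 * g * (b0 * D%:R) by rewrite -b0E; ring.
  by rewrite (ler_pM2l g4) ler_wpM2r.
exists B; split.
- rewrite B0 -(ler_nat R) /= -(ler_pM2r g4); apply: le_trans (_ : w <= _).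
    by rewrite -b0E ler_pM2r.
  by rewrite mulrC.
- by rewrite -b0E; nra.
- rewrite -(ler_nat R); nra.
have [->|m0] := posnP m; first by rewrite !mulr0 ler0n.
case: (posnP K) => [K0|K0]; first by rewrite K0 !(mulr0, mul0r) ler0n.
have kb0 : 0 < K%:R * betap by rewrite mulr_gt0 // ltr0n.
have m0' : 0 < m%:R :> R by rewrite ltr0n.
have rDm : 0 <= r * D%:R / m%:R.
  by apply: divr_ge0; [apply: mulr_ge0; [lra|] | exact: ltW].
have x0 : 0 <= alpha / Num.sqrt (K%:R * betap) * Num.sqrt (r * D%:R / m%:R).
  apply: mulr_ge0; last exact: sqrtr_ge0.
  by apply: divr_ge0; [lra | exact: sqrtr_ge0].
have : (16 * g) ^+ 2 <= w * D%:R / (K%:R * betap * m%:R).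
  have -> : w * D%:R / (K%:R * betap * m%:R) =
      (alpha / Num.sqrt (K%:R * betap) * Num.sqrt (r * D%:R / m%:R)) ^+ 2.
    rewrite [RHS]exprMn [X in _ = X * _]exprMn exprVn.
    rewrite (sqr_sqrtr (ltW kb0)) (sqr_sqrtr rDm) /w.
    by field; rewrite !gt_eqF // ltr0n.
  by apply: lerXn2r; rewrite ?nnegrE ?gx //; lra.
rewrite ler_pdivlMr; last by apply: mulr_gt0.
move=> /le_trans /(_ DB).
have g8 : 0 < 8 * g by lra.
have -> : (16 * g) ^+ 2 * (K%:R * betap * m%:R) =
    8 * g * (16 * (2 * K%:R * betap * g * m%:R)) by ring.
by rewrite ler_pM2l.
Qed.

Theorem theorem2 (R : realType) :
  exists C0 C1 C2 : R, [/\ 0 < C0, 0 < C1, 0 < C2 &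
  forall (alpha r : R) (d1 d2 : nat),
    1 <= alpha -> (1 <= d1)%N -> (1 <= d2)%N -> 4 <= r ->
    C0 <= alpha ^+ 2 * r * (maxn d1 d2)%:R ->
  forall (K : nat) (f : 'I_K -> R -> R) (L betam betap : R),
    link_functions alpha f L betam betap ->
    (forall k : 'I_K, (k.+1 < K)%N ->
      {in `[alpha - 1 / 4, alpha] &, forall x y : R, x <= y -> f k y <= f k x} /\
      {in `[alpha - 1 / 4, alpha] &, forall x y : R, x <= y ->
         (f k)^`()%classic x <= (f k)^`()%classic y}) ->
    (forall k : 'I_K, k.+1 = K -> 1 / 2 < f k (alpha - 1 / 4)) ->
  forall (A : Type) (a : 'I_K -> A), injective a ->
  forall (Omega : {set 'I_d1 * 'I_d2}),
  let rate := lower_rate C1 C2 alpha r betap d1 d2 K #|Omega| in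
    r * alpha ^+ 2 / (minn d1 d2)%:R < rate ->
  (* a possibly randomized algorithm: u is a random seed of law Q, drawn
     independently of the observations *)
  forall (dU : measure_display) (U : measurableType dU) (Q : probability U R)
    (Mhat : U -> ({e | e \in Omega} -> A) -> 'M[R]_(d1, d2)),
    (forall y i j, measurable_fun [set: U] (fun u => Mhat u y i j)) ->
  exists M : 'M[R]_(d1, d2), candidate_set alpha r M /\
    forall (dT : measure_display) (T : measurableType dT)
      (P : probability T R) (Y : {e | e \in Omega} -> T -> A),
      observations f a M P Y ->
      ((3 / 4)%:E <= (P \x Q)
         [set tu | (rate <=
            frobenius_norm (M - Mhat tu.2 (fun e => Y e tu.1)) ^+ 2
              / (d1%:R * d2%:R))%R])%E].
Proof.
(* With gap ^+ 2 = 64 * rate, the bound gap <= 1 / 4 is rate <= 1 / 1024, and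
   16 * gap ^+ 2 = 1024 * rate; the first constant makes the code length
   at least 32. *)
exists 16, (1 / 1024), (1 / 1024); split=> [|||alpha r d1 d2 alpha1 d10 d20 r4 large
    K f L betam betap links mono last A a aI Omega]; [lra|lra|lra|].
have [rateC1 rateC2] :=
  lower_rate_bounds (1 / 1024) (1 / 1024) alpha r betap d1 d2 K #|Omega|.
set rate := lower_rate _ _ _ _ _ _ _ _ _ in rateC1 rateC2 *.
move=> /= rank_small dU U Q Mhat measMhat.
have mn0 : 0 < (minn d1 d2)%:R :> R by rewrite ltr0n leq_min d10.
have rate0 : 0 < rate.
  apply: le_lt_trans rank_small; apply: divr_ge0; last exact: ltW.
  by apply: mulr_ge0; [exact: le_trans r4 | exact: sqr_ge0].
pose gap := Num.sqrt (64 * rate).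
have g0 : 0 < 64 * rate by rewrite mulr_gt0.
have g1 : 64 * rate <= 1 / 16 by clear -rateC1; lra.
have gapE : gap ^+ 2 = 64 * rate by rewrite sqr_sqrtr // ltW.
have gapI : 0 <= gap <= 1 / 4.
  rewrite sqrtr_ge0 -(ler_pXn2r (n := 2)) ?nnegrE ?sqrtr_ge0 // gapE.
  by apply: le_trans g1 _; clear; lra.
have [||B [Bmin Bgap n32 chin]] := @packing_parameters R alpha r betap (64 * rate)
  d1 d2 K #|Omega| alpha1 d10 d20 r4 large (link_betap_gt0 links) g0 g1.
- by move=> /rateC2; clear; lra.
- move: rank_small; rewrite ltr_pdivrMr // => /ltW; rewrite mulrC => /le_trans; apply.
  by rewrite ler_pM2r //; clear -rate0; lra.
rewrite -gapE in Bgap chin.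
have [I [C [X [sizeC Xcand Xrange sepX]]]] :=
  packing_family d10 d20 alpha1 gapI r4 rate0 gapE Bmin Bgap.
have [z _ zP] := estimation_lower_bound Q alpha1 gapI links mono last aI measMhat
  Xrange sepX (code_size_ge sizeC n32 chin).
by exists (X z).
Qed.
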